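(* Let $R_1$ and $R_2$ be commutative rings with nonzero identity and $R=R_1\times R_2$. Let $M_1$ and $M_2$ be unitary $R_1$- and $R_2$-modules respectively, and let $M=M_1\times M_2$, regarded as an $R$-module componentwise. Let $I_1$ and $I_2$ be ideals of $R_1$ and $R_2$ respectively, with $I=I_1\times I_2$. Then all the following types are $I$-primary submodules of $M_1\times M_2$: (1) $P_1\times P_2$, where $P_i$ is a proper submodule of $M_i$ with $I_iP_i=P_i$ for $i=1,2$. (2) $P_1\times M_2$, where $P_1$ is a primary submodule of $M_1$. (3) $P_1\times M_2$, where $P_1$ is an $I_1$-primary submodule of $M_1$ and $I_2M_2=M_2$. (4) $M_1\times P_2$, where $P_2$ is a primary submodule of $M_2$. (5) $M_1\times P_2$, where $P_2$ is an $I_2$-primary submodule of $M_2$ and $I_1M_1=M_1$.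
   Context: For a commutative ring $A$, an ideal $J$ of $A$ and an $A$-module $X$, a proper submodule $Q$ of $X$ is called a $J$-primary submodule of $X$ if for all $a\in A$ and $x\in X$, $ax\in Q\setminus JQ$ implies $x\in Q$ or $a\in\sqrt{(Q:X)}$, where $(Q:X)=\{a\in A : aX\subseteq Q\}$ and $\sqrt{B}=\{a\in A : a^n\in B\text{ for some positive integer }n\}$ for an ideal $B$ of $A$. A proper submodule $Q$ of $X$ is primary if for all $a\in A$ and $x\in X$, $ax\in Q$ implies $x\in Q$ or $a\in\sqrt{(Q:X)}$. *)

(* Defs.v *)
From HB Require Import structures.
From mathcomp Require Import all_boot all_algebra.
From mathcomp Require Import boolp classical_sets.

Set Implicit Arguments.
Unset Strict Implicit.
Unset Printing Implicit Defensive.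

Import GRing.Theory.
Local Open Scope ring_scope.
Local Open Scope classical_set_scope.

(* Submodules and ideals are arbitrary (Prop-valued) subsets. *)

Definition is_submodule (A : comPzRingType) (X : lmodType A) (Q : set X) : Prop :=
  GRing.submod_closed [in Q].

(* Improper ideals are allowed. *)
Definition is_ideal (A : comPzRingType) (J : set A) : Prop :=
  @is_submodule A A^o J.

Definition proper_submodule (A : comPzRingType) (X : lmodType A) (Q : set X) : Prop :=
  is_submodule Q /\ Q <> setT.

(* The submodule JQ: finite sums of products of an element of J and one of Q. *)
Definition ideal_smul (A : comPzRingType) (X : lmodType A)
    (J : set A) (Q : set X) : set X :=
  [set x | exists (n : nat) (a : 'I_n -> A) (q : 'I_n -> X),
     [/\ forall i, J (a i), forall i, Q (q i) & x = \sum_(i < n) a i *: q i]].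

(* The residual (Q : X). *)
Definition colon (A : comPzRingType) (X : lmodType A) (Q : set X) : set A :=
  [set a | forall x : X, Q (a *: x)].

Definition radical (A : comPzRingType) (B : set A) : set A :=
  [set a | exists2 n : nat, (0 < n)%N & B (a ^+ n)].

Definition primary_submodule (A : comPzRingType) (X : lmodType A) (Q : set X) : Prop :=
  proper_submodule Q /\
  forall (a : A) (x : X), Q (a *: x) -> Q x \/ radical (colon Q) a.

Definition J_primary_submodule (A : comPzRingType) (X : lmodType A)
    (J : set A) (Q : set X) : Prop :=
  proper_submodule Q /\
  forall (a : A) (x : X), (Q `\` ideal_smul J Q) (a *: x) ->
    Q x \/ radical (colon Q) a.

(* M1 * M2 as an (R1 * R2)-module with componentwise action. The alias is
   needed because MathComp's instance on pairs has both factors over one ring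
   acting diagonally. *)
Definition prodmod (R1 R2 : comPzRingType) (M1 : lmodType R1) (M2 : lmodType R2)
  : Type := (M1 * M2)%type.

Section ProdMod.
Variables (R1 R2 : comPzRingType) (M1 : lmodType R1) (M2 : lmodType R2).

HB.instance Definition _ := GRing.Zmodule.copy (prodmod M1 M2) (M1 * M2)%type.

Definition prodmod_scale (r : R1 * R2) (x : prodmod M1 M2) : prodmod M1 M2 :=
  (r.1 *: x.1, r.2 *: x.2).

Fact prodmod_scaleA r s x :
  prodmod_scale r (prodmod_scale s x) = prodmod_scale (r * s) x.
Proof. by congr pair; rewrite /= scalerA. Qed.

Fact prodmod_scale1 : left_id 1 prodmod_scale.
Proof. by case=> x y; congr pair; rewrite /= scale1r. Qed.

Fact prodmod_scaleDr : right_distributive prodmod_scale +%R.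
Proof. by move=> r x y; congr pair; rewrite /= scalerDr. Qed.

Fact prodmod_scaleDl x : {morph prodmod_scale^~ x : r s / r + s}.
Proof. by move=> r s; congr pair; rewrite /= scalerDl. Qed.

HB.instance Definition _ := GRing.Zmodule_isLmodule.Build (R1 * R2)%type
  (prodmod M1 M2) prodmod_scaleA prodmod_scale1 prodmod_scaleDr
  prodmod_scaleDl.

End ProdMod.

(* Main.v *)
(* Since 0 lies in both ideals and both submodules, I1 P1 x I2 P2 is contained
   in I (P1 x P2). In (1) this leaves nothing in Q \ IQ; in (3) and (5) it
   turns membership in Q \ IQ into membership in P_i \ I_i P_i for the proper
   factor. *)
Require Import Defs.
From HB Require Import structures.
From mathcomp Require Import all_boot all_algebra.
From mathcomp Require Import boolp classical_sets.
Local Open Scope ring_scope.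
Local Open Scope classical_set_scope.

Import GRing.Theory.

Section Product.
Set Implicit Arguments.
Unset Strict Implicit.

Variables (R1 R2 : comPzRingType) (M1 : lmodType R1) (M2 : lmodType R2).

(** Restates the boolean closure predicate behind [is_submodule] in [Prop], so that membership can
    be used as a plain proposition. *)
Lemma is_submoduleP (A : comPzRingType) (X : lmodType A) (Q : set X) :
  is_submodule Q <->
  Q 0 /\ forall (a : A) (u v : X), Q u -> Q v -> Q (a *: u + v).
Proof.
have memQ x : (x \in [in Q]) = (x \in Q) by [].
split=> -[]; rewrite ?memQ ?in_setE => Q0 QD; split; rewrite ?memQ ?in_setE //.
  by move=> a u v Qu Qv; apply/set_mem; apply: QD; apply: mem_set.
by move=> a u v; rewrite !memQ !in_setE; apply: QD.
Qed.

Lemma is_submodule0 (A : comPzRingType) (X : lmodType A) (Q : set X) :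
  is_submodule Q -> Q 0.
Proof. by case/is_submoduleP. Qed.

Lemma is_submoduleT (A : comPzRingType) (X : lmodType A) :
  is_submodule [set: X].
Proof. exact/is_submoduleP. Qed.

Lemma is_submodule_prod (P1 : set M1) (P2 : set M2) :
  is_submodule P1 -> is_submodule P2 ->
  is_submodule (P1 `*` P2 : set (prodmod M1 M2)).
Proof.
move=> /is_submoduleP[P10 P1D] /is_submoduleP[P20 P2D].
apply/is_submoduleP; split=> // a u v [u1 u2] [v1 v2].
by split; [apply: P1D|apply: P2D].
Qed.

(** If the product were everything, it would contain [(x, 0)] for every [x], making [P1] everything.
    Properness is asked of one factor so that [P2] may be all of [M2]. *)
Lemma proper_submodule_prodl (P1 : set M1) (P2 : set M2) :
  proper_submodule P1 -> is_submodule P2 ->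
  proper_submodule (P1 `*` P2 : set (prodmod M1 M2)).
Proof.
move=> [sP1 nP1] sP2; split; first exact: is_submodule_prod.
move=> PT; apply: nP1; apply/seteqP; split=> // x _.
by have [] : (P1 `*` P2) (x, 0) by rewrite PT.
Qed.

Lemma proper_submodule_prodr (P1 : set M1) (P2 : set M2) :
  is_submodule P1 -> proper_submodule P2 ->
  proper_submodule (P1 `*` P2 : set (prodmod M1 M2)).
Proof.
move=> sP1 [sP2 nP2]; split; first exact: is_submodule_prod.
move=> PT; apply: nP2; apply/seteqP; split=> // x _.
by have [] : (P1 `*` P2) (0, x) by rewrite PT.
Qed.

(** Two finite sums of products are added by concatenating their families, with [split] choosing the
    block an index belongs to. *)
Lemma ideal_smulD (A : comPzRingType) (X : lmodType A) (J : set A) (Q : set X)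
    (x y : X) :
  ideal_smul J Q x -> ideal_smul J Q y -> ideal_smul J Q (x + y).
Proof.
move=> [n [a [q [Ja Qq ->]]]] [m [b [r [Jb Qr ->]]]].
exists (n + m)%N.
exists (fun i => match split i with inl j => a j | inr k => b k end).
exists (fun i => match split i with inl j => q j | inr k => r k end).
split=> [i|i|]; [by case: split|by case: split|].
rewrite big_split_ord; congr (_ + _); apply: eq_bigr => i _.
  (* [lshift m i] is [unsplit (inl i)] by definition; in this form [unsplitK] evaluates the [split]
     inside the match. *)
  by rewrite -[lshift m i]/(unsplit (inl i)) unsplitK.
by rewrite -[rshift n i]/(unsplit (inr i)) unsplitK.
Qed.

Lemma ideal_smul_prod (I1 : set R1) (I2 : set R2)
    (P1 : set M1) (P2 : set M2) :
  is_ideal I1 -> is_ideal I2 -> is_submodule P1 -> is_submodule P2 ->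
  (ideal_smul I1 P1 `*` ideal_smul I2 P2 : set (prodmod M1 M2)) `<=`
  ideal_smul (I1 `*` I2 : set (R1 * R2)%type) (P1 `*` P2 : set (prodmod M1 M2)).
Proof.
move=> /is_submodule0 I10 /is_submodule0 I20 /is_submodule0 P10 /is_submodule0 P20.
move=> [x y] [/= [n [a [q [Ia Pq ->]]]] [m [b [r [Ib Pr ->]]]]].
set x' := \sum_(i < n) _; set y' := \sum_(i < m) _.
(* The two sums may have different lengths, so they are not paired term by term: each is padded with
   zeros in the other coordinate, and the results are added. *)
have -> : (x', y') = (x', 0) + (0, y') :> prodmod M1 M2.
  by congr pair; rewrite ?addr0 ?add0r.
apply: ideal_smulD.
  exists n, (fun i => (a i, 0)), (fun i => (q i, 0)).
  split=> [i|i|]; [by split; first exact: Ia|by split; first exact: Pq|].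
  (* The embedding [u] to [(u, 0)] is additive, hence commutes with the sum. *)
  transitivity (\sum_(i < n) ((a i *: q i, 0) : prodmod M1 M2)).
    apply: (big_morph (fun u => (u, 0) : prodmod M1 M2)) => // u v.
    by congr pair; rewrite addr0.
  by apply: eq_bigr => i _; congr pair; rewrite /= scaler0.
exists m, (fun i => (0, b i)), (fun i => (0, r i)).
split=> [i|i|]; [by split; last exact: Ib|by split; last exact: Pr|].
transitivity (\sum_(i < m) ((0, b i *: r i) : prodmod M1 M2)).
  apply: (big_morph (fun u => (0, u) : prodmod M1 M2)) => // u v.
  by congr pair; rewrite addr0.
by apply: eq_bigr => i _; congr pair; rewrite /= scaler0.
Qed.

(** The same exponent works: the first projection is a ring morphism, so it commutes with powers,
    and the second coordinate is unconstrained. *)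
Lemma radical_colon_prodl (P1 : set M1) (a : R1 * R2) :
  radical (colon P1) a.1 ->
  radical (colon (P1 `*` [set: M2] : set (prodmod M1 M2))) a.
Proof.
move=> [n n0 Pan]; exists n => // x; split=> //=.
by rewrite (rmorphXn (@fst R1 R2)); apply: Pan.
Qed.

Lemma radical_colon_prodr (P2 : set M2) (a : R1 * R2) :
  radical (colon P2) a.2 ->
  radical (colon ([set: M1] `*` P2 : set (prodmod M1 M2))) a.
Proof.
move=> [n n0 Pan]; exists n => // x; split=> //=.
by rewrite (rmorphXn (@snd R1 R2)); apply: Pan.
Qed.

Lemma primary_prodl (P1 : set M1) :
  primary_submodule P1 ->
  primary_submodule (P1 `*` [set: M2] : set (prodmod M1 M2)).
Proof.
move=> [pP1 P1prim]; split.
  by apply: proper_submodule_prodl => //; apply: is_submoduleT.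
move=> a x [/P1prim[]]; first by left.
by move=> /radical_colon_prodl; right.
Qed.

Lemma primary_prodr (P2 : set M2) :
  primary_submodule P2 ->
  primary_submodule ([set: M1] `*` P2 : set (prodmod M1 M2)).
Proof.
move=> [pP2 P2prim]; split.
  by apply: proper_submodule_prodr => //; apply: is_submoduleT.
move=> a x [_ /P2prim[]]; first by left.
by move=> /radical_colon_prodr; right.
Qed.

(** Removing [ideal_smul J Q] only shrinks the set of products to be tested. *)
Lemma primary_J_primary (A : comPzRingType) (X : lmodType A) (J : set A)
    (Q : set X) :
  primary_submodule Q -> J_primary_submodule J Q.
Proof. by move=> [pQ Qprim]; split=> // a x [/Qprim]. Qed.

Lemma J_primary_prodl (I1 : set R1) (I2 : set R2) (P1 : set M1) :
  is_ideal I1 -> is_ideal I2 ->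
  J_primary_submodule I1 P1 -> ideal_smul I2 [set: M2] = [set: M2] ->
  J_primary_submodule (I1 `*` I2 : set (R1 * R2)%type)
    (P1 `*` [set: M2] : set (prodmod M1 M2)).
Proof.
move=> hI1 hI2 [pP1 P1prim] I2M2; split.
  by apply: proper_submodule_prodl => //; apply: is_submoduleT.
move=> a x [[Pax _] nIP].
case: (P1prim a.1 x.1); [split; [exact: Pax|move=> IPax]|by left|].
  (* If [a.1 *: x.1] were in [ideal_smul I1 P1], then, the second coordinate lying in [ideal_smul I2
     [set: M2]], the whole product [a *: x] would lie in the set excluded by [nIP]. *)
  apply: nIP; apply: ideal_smul_prod => //; first by case: pP1.
    exact: is_submoduleT.
  by split; [exact: IPax|rewrite I2M2].
by move=> /radical_colon_prodl; right.
Qed.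

Lemma J_primary_prodr (I1 : set R1) (I2 : set R2) (P2 : set M2) :
  is_ideal I1 -> is_ideal I2 ->
  J_primary_submodule I2 P2 -> ideal_smul I1 [set: M1] = [set: M1] ->
  J_primary_submodule (I1 `*` I2 : set (R1 * R2)%type)
    ([set: M1] `*` P2 : set (prodmod M1 M2)).
Proof.
move=> hI1 hI2 [pP2 P2prim] I1M1; split.
  by apply: proper_submodule_prodr => //; apply: is_submoduleT.
move=> a x [[_ Pax] nIP].
case: (P2prim a.2 x.2); [split; [exact: Pax|move=> IPax]|by left|].
  apply: nIP; apply: ideal_smul_prod => //; first exact: is_submoduleT.
    by case: pP2.
  by split; [rewrite I1M1|exact: IPax].
by move=> /radical_colon_prodr; right.
Qed.

Lemma J_primary_prod (I1 : set R1) (I2 : set R2)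
    (P1 : set M1) (P2 : set M2) :
  is_ideal I1 -> is_ideal I2 ->
  proper_submodule P1 -> ideal_smul I1 P1 = P1 ->
  is_submodule P2 -> ideal_smul I2 P2 = P2 ->
  J_primary_submodule (I1 `*` I2 : set (R1 * R2)%type)
    (P1 `*` P2 : set (prodmod M1 M2)).
Proof.
move=> hI1 hI2 pP1 IP1 sP2 IP2; split; first exact: proper_submodule_prodl.
(* The condition is vacuous: both factors are fixed by their ideals, so [Pax] itself contradicts
   [nIP]. *)
move=> a x [Pax nIP]; exfalso; apply: nIP.
apply: ideal_smul_prod => //; first by case: pP1.
by rewrite IP1 IP2; exact: Pax.
Qed.

End Product.

Theorem theorem2p9 (R1 R2 : comNzRingType) (M1 : lmodType R1) (M2 : lmodType R2)
    (I1 : set R1) (I2 : set R2) (hI1 : is_ideal I1) (hI2 : is_ideal I2) :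
  let M : lmodType (R1 * R2)%type := prodmod M1 M2 in
  let I : set (R1 * R2) := I1 `*` I2 in
  [/\ (forall (P1 : set M1) (P2 : set M2),
         proper_submodule P1 -> ideal_smul I1 P1 = P1 ->
         proper_submodule P2 -> ideal_smul I2 P2 = P2 ->
         J_primary_submodule I (P1 `*` P2 : set M)),
      (forall P1 : set M1,
         primary_submodule P1 ->
         J_primary_submodule I (P1 `*` [set: M2] : set M)),
      (forall P1 : set M1,
         J_primary_submodule I1 P1 -> ideal_smul I2 [set: M2] = [set: M2] ->
         J_primary_submodule I (P1 `*` [set: M2] : set M)),
      (forall P2 : set M2,
         primary_submodule P2 ->
         J_primary_submodule I ([set: M1] `*` P2 : set M)) &
      (forall P2 : set M2,
         J_primary_submodule I2 P2 -> ideal_smul I1 [set: M1] = [set: M1] ->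
         J_primary_submodule I ([set: M1] `*` P2 : set M))].
Proof.
move=> M I; split.
- by move=> P1 P2 pP1 IP1 [sP2 _] IP2; exact: (@J_primary_prod R1 R2 M1 M2).
(* With a primary factor the product is already primary, hence [J]-primary for every [J]. *)
- move=> P1 P1prim; apply: primary_J_primary.
  exact: (@primary_prodl R1 R2 M1 M2).
- by move=> P1 P1prim IM2; exact: (@J_primary_prodl R1 R2 M1 M2).
- move=> P2 P2prim; apply: primary_J_primary.
  exact: (@primary_prodr R1 R2 M1 M2).
- by move=> P2 P2prim IM1; exact: (@J_primary_prodr R1 R2 M1 M2).
Qed.
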